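(* Let $G=(X,E)$ be a finite connected graph, $x\neq y\in X$, and $W:X\to\mathbb{R}$ a function whose global maximum is attained exactly at $x$ and $y$. Assume there is an involutive automorphism $\sigma$ of $G$ with $\sigma(x)=y$ and $W\circ\sigma=W$. Then, for $H=\Delta-QW$, there is perfect asymptotic tunneling between $x$ and $y$ ($TC(x,y)=TC(y,x)=1$), and the tunneling time is of order $Q^{d(x,y)-1}$.
   Context: $d_v$ is the degree of $v$, $d(\cdot,\cdot)$ the graph distance. The symmetrized Laplacian $\Delta$ has $\Delta(v,v)=1$, $\Delta(v,w)=-1/\sqrt{d_vd_w}$ if $vw\in E$, $0$ otherwise; $H=\Delta-QW$ with $W$ as a diagonal matrix and $Q$ a real parameter. Starting from vertex $u$, the state is $\varphi_t=e^{itH}\chi_u$ ($\chi_u$ the indicator of $u$), depending on $Q$. $TC(u,v)=\liminf_{Q\to\infty}\sup_{t\in[0,\infty)}|\varphi_t(v)|^2$; perfect tunneling means $TC=1$. Tunneling from $u$ to $v$ happens within time $f(Q)$ if $TC(u,v)=\liminf_{Q\to\infty}\sup_{t\in[0,f(Q)]}|\varphi_t(v)|^2$; ''tunneling time of order $g(Q)$'' means tunneling happens within some time $f(Q)=O(g(Q))$ but not within any time $f(Q)=o(g(Q))$. *)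

(* Defs.v *)
From HB Require Import structures.
From mathcomp Require Import all_boot all_order all_algebra.
From mathcomp Require Import all_classical all_reals all_analysis.
From mathcomp Require Import complex.
Set Implicit Arguments. Unset Strict Implicit. Unset Printing Implicit Defensive.
Import Order.TTheory GRing.Theory Num.Theory.
Import numFieldNormedType.Exports.
Local Open Scope classical_set_scope.
Local Open Scope ring_scope.

Section QuantumTunneling.
Variables (R : realType) (n : nat).

Definition simple_graph (e : rel 'I_n) : Prop := symmetric e /\ irreflexive e.
Definition connected_graph (e : rel 'I_n) : Prop := forall a b, connect e a b.

(* graph distance: least length of a walk from x to y (walks of length < n suffice
   in a connected graph). *)
Definition gdist (e : rel 'I_n) (x y : 'I_n) : nat :=
  find (fun k => [exists p : k.-tuple 'I_n, path e x p && (last x p == y)])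
       (iota 0 n).

Definition graph_aut (e : rel 'I_n) (s : 'I_n -> 'I_n) : Prop :=
  bijective s /\ forall a b, e (s a) (s b) = e a b.

Definition degree (e : rel 'I_n) (v : 'I_n) : R := #|[set w | e v w]|%:R.

Definition sym_laplacian (e : rel 'I_n) : 'M[R]_n :=
  \matrix_(v, w) (if v == w then 1
                  else if e v w then - (Num.sqrt (degree e v * degree e w))^-1
                  else 0).

Definition hamiltonian (e : rel 'I_n) (W : 'I_n -> R) (Q : R) : 'M[R]_n :=
  sym_laplacian e - Q *: diag_mx (\row_v W v).

Local Open Scope complex_scope.
(* N-th partial sum of the exponential series of (e^{itH} chi_u)(v) = (e^{itH})_{v,u} *)
Definition evol_partial (H : 'M[R]_n) (t : R) (u v : 'I_n) (N : nat) : R[i] :=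
  \sum_(k < N) ((t *i) ^+ k / (k`!)%:R) * ((map_mx (real_complex R) H) ^+ k) v u.
Local Close Scope complex_scope.

(* |phi_t(v)|^2 where phi_t = e^{itH} chi_u *)
Definition amp2 (H : 'M[R]_n) (t : R) (u v : 'I_n) : R :=
  (limn (fun N => complex.Re (evol_partial H t u v N))) ^+ 2
  + (limn (fun N => complex.Im (evol_partial H t u v N))) ^+ 2.

Definition liminf_sup (e : rel 'I_n) (W : 'I_n -> R) (u v : 'I_n)
    (T : R -> set R) : \bar R :=
  limf_einf (fun Q => ereal_sup [set (amp2 (hamiltonian e W Q) t u v)%:E | t in T Q])
            (pinfty_nbhs R).

Definition TC (e : rel 'I_n) (W : 'I_n -> R) (u v : 'I_n) : \bar R :=
  liminf_sup e W u v (fun _ => [set t | 0 <= t]).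

Definition tunnels_within (e : rel 'I_n) (W : 'I_n -> R) (u v : 'I_n)
    (f : R -> R) : Prop :=
  TC e W u v = liminf_sup e W u v (fun Q => [set t | 0 <= t <= f Q]).

Definition bigO_oo (f g : R -> R) : Prop :=
  exists C : R, \forall Q \near pinfty_nbhs R, `|f Q| <= C * `|g Q|.
Definition littleo_oo (f g : R -> R) : Prop :=
  forall eps : R, 0 < eps -> \forall Q \near pinfty_nbhs R, `|f Q| <= eps * `|g Q|.

Definition tunneling_time_of_order (e : rel 'I_n) (W : 'I_n -> R) (u v : 'I_n)
    (g : R -> R) : Prop :=
  (exists f, bigO_oo f g /\ tunnels_within e W u v f) /\
  (forall f, littleo_oo f g -> ~ tunnels_within e W u v f).

End QuantumTunneling.

(* Main.v *)
(** Up to an energy shift, [H = Q w - A] with [A] the normalised adjacency matrix and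
    [w = W x - W >= 0], which vanishes only at [x] and [y].  For each sign, [H] moves
    [chi_x ± chi_y] by an amount bounded in [Q], so it has an eigenvector of the same
    parity under [sigma], not orthogonal to it and with bounded eigenvalue.  Scale it to
    be [1] at [x]; then it is [±1] at [y], and as [Q] tends to infinity the eigenvalue
    equation makes its other entries bounded, hence vanishing.  So [chi_x] is
    asymptotically the half sum of the even and odd eigenvectors, and [|phi_t(y)|^2]
    approaches the Rabi oscillation [sin(t delta)^2] uniformly in [t], where [delta] is
    half the difference of the two eigenvalues.

    The half difference [beta] of the eigenvectors is [0] at [x] and [1] at [y], and each
    step away from [y] costs a factor [Q]: [Q^d(r,y) beta(r)] converges to a sum of
    positive weights over the geodesics from [r] to [y].  The equation at [x] reads
    [delta = \sum_s A x s beta(s)], so [Q^(d(x,y)-1) delta] has a positive limit. *)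

Require Import Defs.
From mathcomp Require Import all_boot all_order all_algebra all_fingroup.
From mathcomp Require Import all_classical all_reals all_analysis.
From mathcomp Require Import complex.
From mathcomp Require Import ring lra.
Import Order.TTheory GRing.Theory Num.Theory.
Import numFieldNormedType.Exports.
Local Open Scope classical_set_scope.
Local Open Scope ring_scope.
Set Implicit Arguments. Unset Strict Implicit. Unset Printing Implicit Defensive.

Section RealAnalysis.
Variable R : realType.

Lemma norm_sqrB_le (a b c : R) : `|a| <= 1 -> `|b| <= 1 -> `|a - b| <= c ->
  `|a ^+ 2 - b ^+ 2| <= 2 * c.
Proof.
move=> a1 b1 abc; rewrite subr_sqr normrM mulrC ler_pM //.
by apply: le_trans (ler_normD _ _) _; lra.
Qed.

Lemma sqr_cosB_sqr_sinB (a b : R) :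
  (cos a - cos b) ^+ 2 + (sin a - sin b) ^+ 2 = 4 * sin ((b - a) / 2) ^+ 2.
Proof.
have : cos (b - a) = 1 - 2 * sin ((b - a) / 2) ^+ 2.
  by rewrite [in LHS](splitr (b - a)) -mulr2n cos_mulr2n cos2sin2 mulr2n; ring.
by rewrite cosB; have := cos2Dsin2 a; have := cos2Dsin2 b; lra.
Qed.

Lemma norm_sin_le (z : R) : `|sin z| <= `|z|.
Proof.
wlog z_ge0 : z / 0 <= z.
  move=> sin_le; case/orP: (le_total 0 z) => [/sin_le //|z_le0].
  by rewrite -[leLHS]normrN -[leRHS]normrN -sinN sin_le // oppr_ge0.
have sin_cont : {within `[0, z], continuous (sin : R -> R)}.
  exact/continuous_subspaceT/continuous_sin.
have [c _] := MVT_segment z_ge0 (fun r _ => is_derive_sin r) sin_cont.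
by rewrite sin0 !subr0 => ->; rewrite normrM ler_piMl ?cos_max.
Qed.

Lemma cvg_inv_pinfty : Q^-1 @[Q --> +oo] --> (0 : R).
Proof. by apply/gtr0_cvgV0; [exact: nbhs_pinfty_gt|exact: cvg_id]. Qed.

Lemma bounded_mul_cvg0 (T : Type) (F : set_system T) {FF : Filter F} (f g : T -> R) K :
  (\forall t \near F, `|f t| <= K) -> g t @[t --> F] --> 0 ->
  f t * g t @[t --> F] --> 0.
Proof.
move=> f_le g0; apply/norm_cvg0P.
apply: (@squeeze_cvgr _ _ _ _ (fun=> 0) (fun t => K * `|g t|)); last 2 first.
- exact: cvg_cst.
- by rewrite -[X in _ --> X](mulr0 K); apply: cvgMl_tmp; apply/norm_cvg0P.
by apply: filterS f_le => t ft; rewrite normr_ge0 normrM ler_wpM2r.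
Qed.

Lemma limf_einf_le_near (T : choiceType) (X : filteredType T) (F : set_system X)
    (f : X -> \bar R) (c : \bar R) :
  ProperFilter F -> (\forall t \near F, (f t <= c)%E) -> (limf_einf f F <= c)%E.
Proof.
move=> FF f_le; rewrite limf_einfE; apply: ge_ereal_sup => _ [V FV <-].
have [t [Vt ft]] : V `&` [set t | f t <= c]%E !=set0.
  exact/(@filter_ex _ F)/filterI.
by apply: le_trans ft; apply: ereal_inf_lbound; exists t.
Qed.

Lemma limf_einf_ge_near (T : choiceType) (X : filteredType T) (F : set_system X)
    (f : X -> \bar R) (c : \bar R) :
  (\forall t \near F, (c <= f t)%E) -> (c <= limf_einf f F)%E.
Proof.
move=> f_ge; rewrite limf_einfE; apply: le_ereal_sup_tmp.
exists (ereal_inf (f @` [set t | c <= f t]%E)); first by exists [set t | c <= f t]%E.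
by apply: le_ereal_inf_tmp => _ [t ct <-].
Qed.
End RealAnalysis.

Section RealLinearParts.
Variables (R : realType) (part : R[i] -> R).
Hypothesis partD : {morph part : a b / a + b}.
Hypothesis part_mul_real : forall z c, part (z * real_complex R c) = part z * c.

Lemma part_sum (I : Type) (r : seq I) (f : I -> R[i]) :
  part (\sum_(i <- r) f i) = \sum_(i <- r) part (f i).
Proof.
apply: (big_morph part partD).
by have := part_mul_real 0 0; rewrite !(mul0r, mulr0).
Qed.

Lemma map_part_eigen m n (P : 'M[R[i]]_(m, n)) (M : 'M[R]_n) (l : 'rV[R]_m) :
  P *m map_mx (real_complex R) M = diag_mx (map_mx (real_complex R) l) *m P ->
  map_mx part P *m M = diag_mx l *m map_mx part P.
Proof.
move=> /matrixP P_eig; apply/matrixP => i j; have := congr1 part (P_eig i j).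
rewrite !mul_diag_mx !mxE part_sum mulrC part_mul_real mulrC => <-.
by apply: eq_bigr => k _; rewrite !mxE part_mul_real.
Qed.
End RealLinearParts.

Section ComplexParts.
Variable R : realType.

Lemma complex_ReIm_inj (z z' : R[i]) :
  complex.Re z = complex.Re z' -> complex.Im z = complex.Im z' -> z = z'.
Proof. by case: z z' => [a b] [c d] /= -> ->. Qed.

Lemma complex_ReD : {morph @complex.Re R : a b / a + b}.
Proof. by move=> [a b] [c d]. Qed.

Lemma complex_ImD : {morph @complex.Im R : a b / a + b}.
Proof. by move=> [a b] [c d]. Qed.

Lemma complex_Re_mul_real (z : R[i]) (c : R) :
  complex.Re (z * real_complex R c) = complex.Re z * c.
Proof. by case: z => a b /=; rewrite mulr0 subr0. Qed.

Lemma complex_Im_mul_real (z : R[i]) (c : R) :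
  complex.Im (z * real_complex R c) = complex.Im z * c.
Proof. by case: z => a b /=; rewrite mulr0 add0r. Qed.

Lemma complex_Re_sum (I : Type) (r : seq I) (f : I -> R[i]) :
  complex.Re (\sum_(i <- r) f i) = \sum_(i <- r) complex.Re (f i).
Proof. exact: part_sum complex_ReD complex_Re_mul_real _ _ _. Qed.

Lemma complex_Im_sum (I : Type) (r : seq I) (f : I -> R[i]) :
  complex.Im (\sum_(i <- r) f i) = \sum_(i <- r) complex.Im (f i).
Proof. exact: part_sum complex_ImD complex_Im_mul_real _ _ _. Qed.

Lemma expr_i_trig_coeff (s : R) k :
  'i%C ^+ k * real_complex R (s ^+ k / k`!%:R) =
  Complex (cos_coeff s k) (sin_coeff s k).
Proof.
have -> : 'i%C ^+ k =
    Complex ((~~ odd k)%:R * (-1) ^+ k./2) ((odd k)%:R * (-1) ^+ k.-1./2) :> R[i].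
  elim: k => [|k IHk]; first by rewrite expr0 /= mul1r mul0r.
  rewrite exprS IHk /=; case: k {IHk} => [|k] /=.
    by apply: complex_ReIm_inj => /=; ring.
  rewrite negbK; case: (odd k) => /=.
    by apply: complex_ReIm_inj; rewrite /= ?exprS; ring.
  by apply: complex_ReIm_inj; rewrite /= ?exprS; ring.
rewrite /cos_coeff /sin_coeff; apply: complex_ReIm_inj => /=.
  by rewrite -?exprnP; ring.
by rewrite -?exprnP; ring.
Qed.
End ComplexParts.

Section Eigenframe.
Variable R : realType.

(* The rows of [F] are a Parseval frame of eigenvectors: over the reals, it is easier to
   get than an orthonormal eigenbasis, and as good for all that follows. *)
Definition eigenframe m n (M : 'M[R]_n) (l : 'rV[R]_m) (F : 'M[R]_(m, n)) : Prop :=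
  F *m M = diag_mx l *m F /\ F^T *m F = 1%:M.

Lemma symmetric_unitary_diag n (M : 'M[R]_n) : M^T = M ->
  exists (P : 'M[R[i]]_n) (l : 'rV[R]_n),
    P *m map_mx (real_complex R) M = diag_mx (map_mx (real_complex R) l) *m P /\
    map_mx Num.conj P^T *m P = 1%:M.
Proof.
move=> M_sym; set A := map_mx (real_complex R) M.
have A_sym : A \is symmetricmx.
  by apply/is_hermitianmxP; rewrite expr0 scale1r map_mx_id // map_trmx M_sym.
have A_real : A \is a realmx.
  by apply/mxOverP => i j; rewrite mxE; apply/complex_realP; exists (M i j).
have A_herm := realsym_hermsym A_sym A_real.
have /orthomx_spectralP A_diag := hermitian_normalmx A_herm.
have /mxOverP lam_real := hermitian_spectral_diag_real A_herm.
set P := spectralmx A in A_diag; set lam := spectral_diag A in A_diag lam_real.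
have P_unit : P \in unitmx := spectral_unit A.
exists P, (map_mx (@complex.Re R) lam); split.
  have -> : map_mx (real_complex R) (map_mx (@complex.Re R) lam) = lam.
    by apply/matrixP => i j; rewrite !mxE (RRe_real (lam_real i j)).
  by rewrite {1}A_diag !mulmxA mulmxV ?mul1mx.
by rewrite -invmx_unitary ?spectral_unitarymx // mulVmx.
Qed.

(* The real and imaginary parts of a unitary eigenbasis. *)
Lemma symmetric_eigenframe n (M : 'M[R]_n) : M^T = M ->
  exists (l : 'rV[R]_(n + n)) (F : 'M[R]_(n + n, n)), eigenframe M l F.
Proof.
move=> /symmetric_unitary_diag[P [l [P_eig P_isometry]]].
exists (row_mx l l), (col_mx (map_mx (@complex.Re R) P) (map_mx (@complex.Im R) P)).
split.
  rewrite mul_col_mx diag_mx_row mul_block_col !mul0mx addr0 add0r.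
  rewrite (map_part_eigen (@complex_ReD R) (@complex_Re_mul_real R) P_eig).
  by rewrite (map_part_eigen (@complex_ImD R) (@complex_Im_mul_real R) P_eig).
rewrite tr_col_mx mul_row_col; apply/matrixP => u v.
have /(congr1 (@complex.Re R)) := congr1 (fun B : 'M[R[i]]_n => B u v) P_isometry.
rewrite !mxE complex_Re_sum -big_split /=.
have -> : complex.Re ((u == v)%:R : R[i]) = (u == v)%:R by case: (u == v).
move=> <-; apply: eq_bigr => j _; rewrite !mxE /=.
by case: (P j u) (P j v) => [a b] [c d] /=; ring.
Qed.

Section FunctionalCalculus.
Variables (m n : nat) (M : 'M[R]_n) (l : 'rV[R]_m) (F : 'M[R]_(m, n)).

Definition spectral_map (g : R -> R) : 'M[R]_n :=
  F^T *m diag_mx (map_mx g l) *m F.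

Lemma spectral_mapE g u v : spectral_map g u v = \sum_i F i u * F i v * g (l 0 i).
Proof.
rewrite /spectral_map -mulmxA mxE; apply: eq_bigr => i _.
by rewrite mul_diag_mx !mxE; ring.
Qed.

Hypothesis frameF : eigenframe M l F.

Lemma spectral_map_exp k : M ^+ k = spectral_map (fun z => z ^+ k).
Proof.
have [eigF FtF] := frameF.
elim: k => [|k IHk].
  have -> : spectral_map (fun z => z ^+ 0) = F^T *m F.
    rewrite /spectral_map -mulmxA; congr (_ *m _).
    by apply/matrixP => i j; rewrite mul_diag_mx !mxE expr0 mul1r.
  by rewrite FtF.
rewrite exprSr IHk -[LHS]/(spectral_map _ *m M) /spectral_map.
rewrite -!mulmxA eigF; congr (_ *m _).
by apply/matrixP => i j; rewrite !mul_diag_mx !mxE exprSr mulrA.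
Qed.

Lemma spectral_map_eigen g (z : 'cV[R]_n) E :
  M *m z = E *: z -> spectral_map g *m z = g E *: z.
Proof.
have [eigF FtF] := frameF => zE.
have gFz : diag_mx (map_mx g l) *m (F *m z) = g E *: (F *m z).
  have : diag_mx l *m (F *m z) = E *: (F *m z).
    by rewrite mulmxA -eigF -mulmxA zE -scalemxAr.
  move: (F *m z) => y yE; apply/matrixP => i j; move/matrixP/(_ i j): yE.
  rewrite !mul_diag_mx !mxE; have [->|y0] := eqVneq (y i j) 0; first by rewrite !mulr0.
  by move=> /(mulIf y0) ->.
by rewrite /spectral_map -!mulmxA gFz -scalemxAr mulmxA FtF mul1mx.
Qed.

Lemma spectral_map_le1 g u v : (forall z, `|g z| <= 1) -> `|spectral_map g u v| <= 1.
Proof.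
move=> g_le1; have [_ FtF] := frameF.
have row_norm w : \sum_i F i w ^+ 2 = 1.
  have := congr1 (fun B : 'M[R]_n => B w w) FtF; rewrite !mxE eqxx mulr1n => <-.
  by apply: eq_bigr => i _; rewrite !mxE expr2.
rewrite spectral_mapE; apply: le_trans (ler_norm_sum _ _ _) _.
have -> : 1 = \sum_i (F i u ^+ 2 + F i v ^+ 2) / 2.
  by rewrite -mulr_suml big_split /= !row_norm; lra.
apply: ler_sum => i _; rewrite normrM.
apply: le_trans (ler_piMr (normr_ge0 _) (g_le1 _)) _; rewrite ler_norml.
by have := sqr_ge0 (F i u - F i v); have := sqr_ge0 (F i u + F i v); lra.
Qed.
Lemma evol_partialE t u v N : evol_partial M t u v N =
  Complex (\sum_i F i v * F i u * series (cos_coeff (t * l 0 i)) N)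
          (\sum_i F i v * F i u * series (sin_coeff (t * l 0 i)) N).
Proof.
transitivity (\sum_(k < N) \sum_i
   (Complex (cos_coeff (t * l 0 i) k) (sin_coeff (t * l 0 i) k) : R[i]) *
   real_complex R (F i v * F i u)).
  apply: eq_bigr => k _.
  have -> : map_mx (real_complex R) M ^+ k = map_mx (real_complex R) (M ^+ k).
    elim: (nat_of_ord k) => [|j IHj]; first by rewrite !expr0 [RHS]map_mx1.
    by rewrite !exprS IHj -[RHS]/(map_mx _ (M *m _)) map_mxM.
  rewrite mxE spectral_map_exp spectral_mapE rmorph_sum mulr_sumr.
  apply: eq_bigr => i _; rewrite -expr_i_trig_coeff.
  have -> : (Complex 0 t : R[i]) = 'i%C * real_complex R t.
    by apply: complex_ReIm_inj => /=; ring.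
  by rewrite !(rmorphM, rmorphXn, fmorphV, rmorph_nat) /= !exprMn; ring.
rewrite exchange_big /=; apply: complex_ReIm_inj;
  rewrite ?complex_Re_sum ?complex_Im_sum /=; apply: eq_bigr => i _.
  rewrite complex_Re_sum seriesEord mulr_sumr.
  by apply: eq_bigr => k _; rewrite complex_Re_mul_real mulrC.
rewrite complex_Im_sum seriesEord mulr_sumr.
by apply: eq_bigr => k _; rewrite complex_Im_mul_real mulrC.
Qed.

Lemma amp2E t u v : amp2 M t u v =
  spectral_map (fun z => cos (t * z)) v u ^+ 2 +
  spectral_map (fun z => sin (t * z)) v u ^+ 2.
Proof.
rewrite /amp2 !spectral_mapE; congr (_ ^+ 2 + _ ^+ 2); apply: cvg_lim => //.
  under eq_fun do rewrite evol_partialE /=.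
  apply: cvg_big => [|i _]; first exact: add_continuous.
  by apply: cvgMl_tmp; rewrite unlock; exact: is_cvg_series_cos_coeff.
under eq_fun do rewrite evol_partialE /=.
apply: cvg_big => [|i _]; first exact: add_continuous.
by apply: cvgMl_tmp; rewrite unlock; exact: is_cvg_series_sin_coeff.
Qed.
End FunctionalCalculus.

Lemma amp2C n (M : 'M[R]_n) t u v : M^T = M -> amp2 M t u v = amp2 M t v u.
Proof.
move=> /symmetric_eigenframe[l [F frameF]]; rewrite !(amp2E frameF) !spectral_mapE.
by congr (_ ^+ 2 + _ ^+ 2); apply: eq_bigr => i _; rewrite [F i u * _]mulrC.
Qed.
End Eigenframe.

Section TwoLevelEvolution.
Variables (R : realType) (n : nat) (H : 'M[R]_n) (x y : 'I_n).
Variables (E_even E_odd : R) (z_even z_odd : 'cV[R]_n).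
Hypothesis xy : x != y.
Hypothesis H_sym : H^T = H.
Hypothesis even_eigen : H *m z_even = E_even *: z_even.
Hypothesis odd_eigen : H *m z_odd = E_odd *: z_odd.
Hypothesis even_x : z_even x 0 = 1.
Hypothesis even_y : z_even y 0 = 1.
Hypothesis odd_x : z_odd x 0 = 1.
Hypothesis odd_y : z_odd y 0 = -1.

Definition leakage : R :=
  \sum_(r | (r != x) && (r != y)) `|(2^-1 *: (z_even + z_odd)) r 0|.

(* [(z_even + z_odd) / 2] is the indicator of [x] up to the leakage. *)
Lemma spectral_map_two_level k (l : 'rV[R]_k) (F : 'M[R]_(k, n)) (g : R -> R) :
  eigenframe H l F -> (forall z, `|g z| <= 1) ->
  `|spectral_map l F g y x - (g E_even - g E_odd) / 2| <= leakage.
Proof.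
move=> frameF g_le1; set G := spectral_map l F g.
set a := 2^-1 *: (z_even + z_odd).
have Ga_y : (G *m a) y 0 = (g E_even - g E_odd) / 2.
  rewrite -scalemxAr mulmxDr (spectral_map_eigen frameF _ even_eigen).
  by rewrite (spectral_map_eigen frameF _ odd_eigen) !mxE even_y odd_y; lra.
have Ga_split : (G *m a) y 0 =
    G y x + \sum_(r | (r != x) && (r != y)) G y r * a r 0.
  rewrite mxE (bigD1 x) //= (bigD1 y) 1?eq_sym //= [a x 0]mxE [a y 0]mxE.
  by rewrite ![(z_even + z_odd) _ _]mxE even_x even_y odd_x odd_y; lra.
rewrite -Ga_y Ga_split opprD addrA subrr add0r normrN.
apply: le_trans (ler_norm_sum _ _ _) _; apply: ler_sum => r _.
by rewrite normrM ler_piMl // (spectral_map_le1 frameF).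
Qed.

Lemma amp2_two_level t :
  `|amp2 H t x y - sin (t * ((E_odd - E_even) / 2)) ^+ 2| <= 4 * leakage.
Proof.
have [l [F frameF]] := symmetric_eigenframe H_sym.
have close g : (forall z, `|g z| <= 1) ->
    `|spectral_map l F g y x ^+ 2 - ((g E_even - g E_odd) / 2) ^+ 2| <= 2 * leakage.
  move=> g_le1; apply: norm_sqrB_le; first exact: (spectral_map_le1 frameF).
    rewrite normrM [`|2^-1|]ger0_norm //; have := ler_normB (g E_even) (g E_odd).
    by have := g_le1 E_even; have := g_le1 E_odd; lra.
  exact: spectral_map_two_level.
have -> : sin (t * ((E_odd - E_even) / 2)) ^+ 2 =
    ((cos (t * E_even) - cos (t * E_odd)) / 2) ^+ 2 +
    ((sin (t * E_even) - sin (t * E_odd)) / 2) ^+ 2.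
  have := sqr_cosB_sqr_sinB (t * E_even) (t * E_odd).
  by rewrite -mulrBr mulrA; lra.
rewrite (amp2E frameF) opprD addrACA.
have cos_close := close (fun z => cos (t * z)) (fun z => cos_max _).
have sin_close := close (fun z => sin (t * z)) (fun z => sin_max _).
by apply: le_trans (ler_normD _ _) _; lra.
Qed.
End TwoLevelEvolution.

Section RabiOscillation.
Variable R : realType.

Definition rabi_oscillation n (H : R -> 'M[R]_n) (u v : 'I_n) (rate : R -> R) : Prop :=
  forall eps, 0 < eps -> \forall Q \near +oo,
    forall t, `|amp2 (H Q) t u v - sin (t * rate Q) ^+ 2| <= eps.

Lemma rabi_oscillationC n (H : R -> 'M[R]_n) u v rate :
  (forall Q, (H Q)^T = H Q) -> rabi_oscillation H u v rate ->
  rabi_oscillation H v u rate.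
Proof.
move=> H_sym rabi eps /rabi; apply: filterS => Q close t.
by rewrite amp2C.
Qed.

Section RabiTunneling.
Variables (n : nat) (e : rel 'I_n) (W : 'I_n -> R) (u v : 'I_n).
Variables (rate g : R -> R) (kappa : R).
Hypothesis rabi : rabi_oscillation (hamiltonian e W) u v rate.
Hypothesis g_gt0 : \forall Q \near +oo, 0 < g Q.
Hypothesis kappa_gt0 : 0 < kappa.
Hypothesis rate_cvg : rate Q * g Q @[Q --> +oo] --> kappa.

Lemma rabi_liminf_sup_le1 (T : R -> set R) : (liminf_sup e W u v T <= 1)%E.
Proof.
apply/lee_addgt0Pr => eps eps_gt0; apply: limf_einf_le_near.
apply: filterS (rabi eps_gt0) => Q close.
apply: ge_ereal_sup => _ [t _ <-]; rewrite -EFinD lee_fin.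
have := close t; rewrite ler_norml => /andP[_].
by have := cos2Dsin2 (t * rate Q); have := sqr_ge0 (cos (t * rate Q)); lra.
Qed.

(* At time [pi / (2 rate)], at most [(pi / kappa) g] for large [Q], the transfer is
   complete. *)
Lemma rabi_liminf_sup_ge1 (T : R -> set R) :
  (\forall Q \near +oo, forall t, 0 <= t <= pi / kappa * g Q -> T Q t) ->
  (1 <= liminf_sup e W u v T)%E.
Proof.
move=> T_long; apply/lee_addgt0Pr => eps eps_gt0; rewrite -leeBlDr //.
apply: limf_einf_ge_near.
have rate_ge : \forall Q \near +oo, kappa / 2 < rate Q * g Q.
  by apply: (cvgr_gt kappa rate_cvg); rewrite ltr_pdivrMr // ltr_pMr // ltr1n.
apply: filterS3 (filterI T_long g_gt0) rate_ge (rabi eps_gt0) => Q [TQ gQ] rateQ close.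
have rate_gt0 : 0 < rate Q.
  by rewrite -(pmulr_lgt0 _ gQ) (lt_trans _ rateQ) // divr_gt0.
pose t := pi / 2 / rate Q.
have Tt : T Q t.
  have t_ge0 : 0 <= t by rewrite !divr_ge0 ?pi_ge0 ?ltW.
  apply: TQ; rewrite t_ge0 /t ler_pdivrMr // -!mulrA ler_pM2l ?pi_gt0 //.
  by rewrite ler_pdivlMl // [g Q * _]mulrC ltW.
apply: (@le_trans _ _ (amp2 (hamiltonian e W Q) t u v)%:E); last first.
  by apply: ereal_sup_ubound; exists t.
rewrite -EFinB lee_fin; have := close t.
by rewrite /t divfK ?gt_eqF // sin_pihalf expr1n ler_norml => /andP[+ _]; lra.
Qed.

(* Within [o(g)] the phase [t * rate] tends to [0]. *)
Lemma rabi_liminf_sup_littleo f : littleo_oo f g ->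
  (liminf_sup e W u v (fun Q => [set t | (0 <= t <= f Q)%R]) <= (1 / 2)%:E)%E.
Proof.
move=> f_small; apply: limf_einf_le_near.
have rate_lt : \forall Q \near +oo, `|rate Q * g Q| < 2 * kappa.
  by apply: (cvgr_norm_lt kappa rate_cvg); rewrite gtr0_norm // ltr_pMl // ltr1n.
have f_le : \forall Q \near +oo, `|f Q| <= (4 * kappa)^-1 * `|g Q|.
  by apply: f_small; rewrite invr_gt0 mulr_gt0.
have quarter_gt0 : 0 < 1 / 4 :> R by lra.
apply: filterS3 rate_lt f_le (rabi quarter_gt0) => Q rateQ fQ close.
apply: ge_ereal_sup => _ [t /andP[t_ge0 t_le] <-]; rewrite lee_fin.
have phase_le : `|t * rate Q| <= 1 / 2.
  rewrite normrM ger0_norm //.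
  have : t * `|rate Q| <= (4 * kappa)^-1 * `|rate Q * g Q|.
    rewrite normrM mulrCA mulrC ler_wpM2l //.
    exact: le_trans t_le (le_trans (ler_norm _) fQ).
  move=> /le_trans; apply; rewrite mulrC ler_pdivrMr ?mulr_gt0 //; lra.
have : sin (t * rate Q) ^+ 2 <= 1 / 4.
  have := le_trans (norm_sin_le _) phase_le; rewrite ler_norml => /andP[? ?]; nra.
by have := close t; rewrite ler_norml => /andP[_]; lra.
Qed.

Lemma rabi_TC : TC e W u v = 1%E.
Proof.
apply/eqP; rewrite eq_le rabi_liminf_sup_le1 /=; apply: rabi_liminf_sup_ge1.
by apply: filterE => Q t /andP[].
Qed.

Lemma rabi_tunneling_time_of_order : tunneling_time_of_order e W u v g.
Proof.
split=> [|f /rabi_liminf_sup_littleo]; rewrite /tunnels_within rabi_TC; last first.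
  by move=> liminf_le eq1; move: liminf_le; rewrite -eq1 lee_fin; lra.
exists (fun Q => pi / kappa * g Q); split.
  exists (pi / kappa); apply: filterE => Q.
  by rewrite normrM ger0_norm // divr_ge0 ?pi_ge0 ?ltW.
apply/esym/eqP; rewrite eq_le rabi_liminf_sup_le1 /=; apply: rabi_liminf_sup_ge1.
exact: filterE.
Qed.
End RabiTunneling.
End RabiOscillation.

Section EigenvectorOverlap.
Variables (R : realType) (n : nat).
Implicit Types (M S : 'M[R]_n) (u v w z : 'cV[R]_n).

Definition dotcv (u v : 'cV[R]_n) : R := (u^T *m v) 0 0.

Lemma dotcvE u v : dotcv u v = \sum_i u i 0 * v i 0.
Proof. by rewrite /dotcv mxE; apply: eq_bigr => i _; rewrite mxE. Qed.

Lemma dotcvNN u v : dotcv (- u) (- v) = dotcv u v.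
Proof. by rewrite !dotcvE; apply: eq_bigr => i _; rewrite !mxE mulrNN. Qed.

Lemma eigenframe_parseval m M (l : 'rV[R]_m) (F : 'M[R]_(m, n)) w :
  eigenframe M l F -> \sum_i (F *m w) i 0 ^+ 2 = dotcv w w.
Proof.
move=> [_ FtF]; have -> : dotcv w w = ((F *m w)^T *m (F *m w)) 0 0.
  by rewrite /dotcv trmx_mul -mulmxA [F^T *m _]mulmxA FtF mul1mx.
by rewrite mxE; apply: eq_bigr => i _; rewrite [_^T _ _]mxE expr2.
Qed.

Lemma symmetric_eigenvector_overlap M w : M^T = M -> 0 < dotcv w w ->
  exists (E : R) z, [/\ M *m z = E *: z, dotcv z w != 0 &
    E ^+ 2 * dotcv w w <= dotcv (M *m w) (M *m w)].
Proof.
move=> Msym w_gt0; have [l [F frameF]] := symmetric_eigenframe Msym.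
have [eigF _] := frameF; set N := dotcv w w in w_gt0 *; set K := dotcv _ _.
pose q i := (F *m w) i 0.
have sum_q : \sum_i q i ^+ 2 = N := eigenframe_parseval w frameF.
have sum_lq : \sum_i (l 0 i * q i) ^+ 2 = K.
  rewrite /K -(eigenframe_parseval _ frameF); apply: eq_bigr => i _.
  by rewrite mulmxA eigF -mulmxA mul_diag_mx [in RHS]mxE.
have [/existsP[i /andP[qi li]]|] :=
    boolP [exists i, (q i != 0) && (l 0 i ^+ 2 * N <= K)].
  exists (l 0 i), (row i F)^T; split => //.
    rewrite -{1}Msym -trmx_mul -row_mul eigF mul_diag_mx.
    by apply/matrixP => v j; rewrite !mxE.
  by rewrite /dotcv trmxK -row_mul mxE.
rewrite negb_exists => /forallP none.
have terms_ge0 i : true -> 0 <= (l 0 i ^+ 2 * N - K) * q i ^+ 2.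
  move=> _; have := none i; rewrite negb_and negbK -ltNge => /orP[/eqP ->|/ltW].
    by rewrite expr0n mulr0.
  by rewrite -subr_ge0 => lNK; rewrite mulr_ge0 ?sqr_ge0.
have sum_terms : \sum_i (l 0 i ^+ 2 * N - K) * q i ^+ 2 = 0.
  transitivity (N * \sum_i (l 0 i * q i) ^+ 2 - K * \sum_i q i ^+ 2).
    by rewrite !mulr_sumr -sumrB; apply: eq_bigr => i _; ring.
  by rewrite sum_lq sum_q; ring.
have q0 i : q i = 0.
  have /eqP := psumr_eq0P terms_ge0 sum_terms (i := i) isT.
  rewrite mulf_eq0 sqrf_eq0 => /orP[/eqP lNK|/eqP //].
  by have := none i; rewrite negb_and negbK -ltNge -subr_gt0 lNK ltxx orbF => /eqP.
by move: w_gt0; rewrite -sum_q big1 ?ltxx // => i _; rewrite q0 expr0n.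
Qed.

Lemma symmetric_eigenvector_overlap_parity M S w eps :
  M^T = M -> S^T = S -> S *m S = 1%:M -> S *m M = M *m S -> eps * eps = 1 ->
  S *m w = eps *: w -> 0 < dotcv w w ->
  exists (E : R) z, [/\ M *m z = E *: z, S *m z = eps *: z, dotcv z w != 0 &
    E ^+ 2 * dotcv w w <= dotcv (M *m w) (M *m w)].
Proof.
move=> Msym Ssym SS SM epsK Sw w_gt0.
have [E [z [zE zw0 E_le]]] := symmetric_eigenvector_overlap Msym w_gt0.
exists E, (z + eps *: (S *m z)); split => //.
- rewrite mulmxDr -scalemxAr mulmxA -SM -mulmxA zE -scalemxAr.
  by rewrite scalerDr !scalerA mulrC.
- by rewrite mulmxDr -scalemxAr mulmxA SS mul1mx scalerDr scalerA epsK scale1r addrC.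
- have -> : dotcv (z + eps *: (S *m z)) w = 2 * dotcv z w.
    rewrite /dotcv linearD linearZ /= trmx_mul Ssym mulmxDl -scalemxAl -mulmxA Sw.
    by rewrite -scalemxAr scalerA epsK scale1r [LHS]mxE mulr_natl mulr2n.
  by rewrite mulf_neq0.
Qed.
End EigenvectorOverlap.

Section GraphDistance.
Variables (n : nat) (e : rel 'I_n).

Lemma gdist_le_size (x y : 'I_n) p :
  path e x p -> last x p = y -> (gdist e x y <= size p)%N.
Proof.
move=> ep py; rewrite /gdist; set walk := fun k => _.
have [lt_pn|] := ltnP (size p) n; last first.
  by apply: leq_trans; rewrite -[X in (_ <= X)%N](size_iota 0 n) find_size.
rewrite leqNgt; apply/negP => /(before_find 0%N).
rewrite nth_iota // add0n /walk => /negbT/negP; apply; apply/existsP.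
by exists (in_tuple p); rewrite /= ep py eqxx.
Qed.

Lemma gdistxx (x : 'I_n) : gdist e x x = 0%N.
Proof. by apply/eqP; rewrite -leqn0; exact: (@gdist_le_size x x [::]). Qed.

Lemma gdist_path (x y : 'I_n) : connect e x y ->
  exists p, [/\ path e x p, last x p = y & size p = gdist e x y].
Proof.
move=> /connectP[p0 ep0 ->]; case: (shortenP ep0) => p ep up _.
pose walk k := [exists q : k.-tuple 'I_n, path e x q && (last x q == last x p)].
have has_walk : has walk (iota 0 n).
  apply/hasP; exists (size p); last first.
    by apply/existsP; exists (in_tuple p); rewrite /= ep eqxx.
  rewrite mem_iota add0n /=; have := max_card (mem (x :: p)).
  by rewrite (card_uniqP up) card_ord.
have := nth_find 0%N has_walk; rewrite nth_iota ?add0n; last first.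
  by rewrite -[X in (_ < X)%N](size_iota 0 n) -has_find.
by move=> /existsP[q /andP[eq /eqP lq]]; exists q; rewrite size_tuple.
Qed.

Hypothesis conn : connected_graph e.

Lemma gdist_eq0 (x y : 'I_n) : (gdist e x y == 0%N) = (x == y).
Proof.
apply/eqP/eqP => [|->]; last exact: gdistxx.
by have [[|s p] [_ <- <-]] := gdist_path (conn x y).
Qed.

Lemma gdist_edge (x s y : 'I_n) : e x s -> (gdist e x y <= (gdist e s y).+1)%N.
Proof.
move=> xs; have [p [ep lp sp]] := gdist_path (conn s y).
by rewrite -sp; apply: (@gdist_le_size x y (s :: p)) => //=; rewrite xs.
Qed.

Lemma gdist_closer (x y : 'I_n) : x != y ->
  exists2 s, e x s & gdist e x y = (gdist e s y).+1.
Proof.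
move=> xy; have [[|s p] [/= ep lp sp]] := gdist_path (conn x y).
  by rewrite lp eqxx in xy.
case/andP: ep => xs ep; exists s => //; apply/eqP; rewrite eqn_leq gdist_edge //=.
by rewrite -sp ltnS; apply: gdist_le_size.
Qed.

Section WeightedWalks.
Variables (R : numDomainType) (G : 'M[R]_n).
Hypothesis G_ge0 : forall r s, 0 <= G r s.

Lemma expmx_ge0 j r s : 0 <= (G ^+ j) r s.
Proof.
elim: j r => [|j IHj] r; first by rewrite expr0 [leRHS]mxE ler0n.
by rewrite exprS [leRHS]mxE sumr_ge0 // => t _; rewrite mulr_ge0.
Qed.

Lemma mulmx_expmx_gt0 (B : 'M[R]_n) j r s y :
  (forall t, 0 <= B r t) -> 0 < B r s -> 0 < (G ^+ j) s y ->
  0 < (B *m G ^+ j) r y.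
Proof.
move=> B_ge0 Brs Gsy; rewrite mxE (bigD1 s) //= ltr_pwDl ?mulr_gt0 //.
by rewrite sumr_ge0 // => t _; rewrite mulr_ge0 ?expmx_ge0.
Qed.

Lemma expmx_gdist_gt0 k r y :
  (forall s t, (gdist e s y <= k)%N -> s != y -> e s t -> 0 < G s t) ->
  (gdist e r y <= k)%N -> 0 < (G ^+ gdist e r y) r y.
Proof.
move=> G_gt0; move def_j: (gdist e r y) => j.
elim: j r def_j => [|j IHj] r def_j le_jk.
  by rewrite expr0 [ltRHS]mxE -gdist_eq0 def_j ltr01.
have ry : r != y by rewrite -gdist_eq0 def_j.
have [s rs] := gdist_closer ry; rewrite def_j => -[def_s].
rewrite exprS; apply: (mulmx_expmx_gt0 (s := s)) => //.
  by apply: G_gt0 => //; rewrite def_j.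
by apply: IHj => //; exact: ltnW.
Qed.
End WeightedWalks.
End GraphDistance.

Section DoubleWell.
Variables (R : realType) (n : nat) (e : rel 'I_n) (x y : 'I_n).
Variables (A : 'M[R]_n) (w : 'rV[R]_n).
Hypothesis conn : connected_graph e.
Hypothesis xy : x != y.
Hypothesis A_edge : forall r s, e r s -> 0 < A r s.
Hypothesis A_nonedge : forall r s, ~~ e r s -> A r s = 0.
Hypothesis w_x : w 0 x = 0.
Hypothesis w_y : w 0 y = 0.
Hypothesis w_gt0 : forall r, r != x -> r != y -> 0 < w 0 r.

Definition double_well (Q : R) : 'M[R]_n := Q *: diag_mx w - A.

Lemma double_well_row Q (z : 'cV[R]_n) r :
  (double_well Q *m z) r 0 = Q * w 0 r * z r 0 - (A *m z) r 0.
Proof.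
by rewrite /double_well mulmxBl -scalemxAl mul_diag_mx !mxE mulrA.
Qed.

Record well_branch (eps : R) (E : R -> R) (z : R -> 'cV[R]_n) : Prop := WellBranch {
  branch_energy_bounded : exists K, forall Q, `|E Q| <= K;
  branch_eigen : forall Q, double_well Q *m z Q = E Q *: z Q;
  branch_x : forall Q, z Q x 0 = 1;
  branch_y : forall Q, z Q y 0 = eps }.

Lemma weight_ge0 r s : 0 <= A r s.
Proof. by have [/A_edge/ltW|/A_nonedge ->] := boolP (e r s). Qed.

Lemma norm_mulmx_le (z : 'cV[R]_n) r c :
  (forall s, `|z s 0| <= c) -> `|(A *m z) r 0| <= (\sum_s A r s) * c.
Proof.
move=> z_le; rewrite mxE mulr_suml; apply: le_trans (ler_norm_sum _ _ _) _.
apply: ler_sum => s _; rewrite normrM (ger0_norm (weight_ge0 r s)).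
by rewrite ler_wpM2l ?weight_ge0.
Qed.

Lemma scaled_resolvent_cvg (E : R -> R) r : (exists K, forall Q, `|E Q| <= K) ->
  r != x -> r != y -> Q / (Q * w 0 r - E Q) @[Q --> +oo] --> (w 0 r)^-1.
Proof.
move=> [K E_le] rx ry; have wr := w_gt0 rx ry.
have EQ_cvg : E Q / Q @[Q --> +oo] --> 0.
  apply: (@bounded_mul_cvg0 _ _ _ _ E (fun Q => Q^-1) K); last exact: cvg_inv_pinfty.
  exact: filterE.
have : (w 0 r - E Q / Q)^-1 @[Q --> +oo] --> (w 0 r)^-1.
  apply: cvgV; first exact: lt0r_neq0.
  by rewrite -[X in _ --> X]subr0; apply: cvgB => //; exact: cvg_cst.
apply: cvg_trans; apply: near_eq_cvg.
apply: filterS (nbhs_pinfty_gt (num_real 0)) => Q Q_gt0.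
have -> : w 0 r - E Q / Q = (Q * w 0 r - E Q) / Q by field; rewrite gt_eqF.
by rewrite invfM invrK mulrC.
Qed.

Lemma barrier_dominates (E : R -> R) (c : 'I_n -> R) :
  (exists K, forall Q, `|E Q| <= K) ->
  \forall Q \near +oo, forall r, r != x -> r != y -> c r < Q * w 0 r - E Q.
Proof.
move=> [K E_le]; apply: filter_forall => r.
have [->|rx] := eqVneq r x; first exact: filterE.
have [->|ry] := eqVneq r y; first exact: filterE.
have wr := w_gt0 rx ry.
apply: filterS (nbhs_pinfty_gt (num_real ((K + c r) / w 0 r))) => Q + _ _.
by rewrite ltr_pdivrMr //; have := E_le Q; rewrite ler_norml => /andP[_]; lra.
Qed.

Lemma branch_row eps E z Q r : well_branch eps E z ->
  (Q * w 0 r - E Q) * z Q r 0 = (A *m z Q) r 0.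
Proof.
move=> Ez; have := congr1 (fun v : 'cV[R]_n => v r 0) (branch_eigen Ez Q).
by rewrite double_well_row [RHS]mxE mulrBl; lra.
Qed.

(* Maximum principle: away from the wells the potential dominates the hopping. *)
Lemma branch_norm_le1 eps E z : well_branch eps E z -> `|eps| <= 1 ->
  \forall Q \near +oo, forall r, `|z Q r 0| <= 1.
Proof.
move=> Ez eps1.
apply: filterS (barrier_dominates (fun r => \sum_s A r s) (branch_energy_bounded Ez)).
move=> Q barrier r.
have [m _ m_max] := arg_maxP (fun r => `|z Q r 0|) (erefl true : xpredT x).
apply: le_trans (m_max r isT) _; rewrite leNgt; apply/negP => m_gt1.
have mx : m != x by apply: contraTneq m_gt1 => ->; rewrite (branch_x Ez) normr1 ltxx.
have my : m != y by apply: contraTneq m_gt1 => ->; rewrite (branch_y Ez) -leNgt.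
have : (Q * w 0 m - E Q) * `|z Q m 0| <= (\sum_s A m s) * `|z Q m 0|.
  apply: (@le_trans _ _ `|(A *m z Q) m 0|).
    by rewrite -(branch_row _ _ Ez) normrM ler_wpM2r // ler_norm.
  by apply: norm_mulmx_le => s; exact: m_max.
by rewrite ler_pM2r ?(lt_trans _ m_gt1) // leNgt barrier.
Qed.

Lemma branch_shift_eigen eps E z c Q : well_branch eps E z ->
  (c%:M + double_well Q) *m z Q = (c + E Q) *: z Q.
Proof. by move=> Ez; rewrite mulmxDl mul_scalar_mx (branch_eigen Ez) scalerDl. Qed.

Lemma branch_interior_cvg0 eps E z r : well_branch eps E z -> `|eps| <= 1 ->
  r != x -> r != y -> z Q r 0 @[Q --> +oo] --> 0.
Proof.
move=> Ez eps1 rx ry; have E_bdd := branch_energy_bounded Ez.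
have Az_bdd : \forall Q \near +oo, `|(A *m z Q) r 0| <= (\sum_s A r s) * 1.
  by apply: filterS (branch_norm_le1 Ez eps1) => Q; exact: norm_mulmx_le.
have resolvent0 : Q^-1 * (Q / (Q * w 0 r - E Q)) @[Q --> +oo] --> 0.
  rewrite -[X in _ --> X](mul0r (w 0 r)^-1).
  by apply: cvgM; [exact: cvg_inv_pinfty|exact: scaled_resolvent_cvg].
apply: cvg_trans (bounded_mul_cvg0 Az_bdd resolvent0); apply: near_eq_cvg.
have := barrier_dominates (fun=> 0) E_bdd.
apply: filterS2 (nbhs_pinfty_gt (num_real 0)) => Q Q_gt0 /(_ r rx ry) barrier.
by rewrite -(branch_row _ _ Ez) mulKf ?gt_eqF // mulrC mulKf ?gt_eqF.
Qed.

Definition hopping : 'M[R]_n := \matrix_(r, s) (A r s / w 0 r).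

(* The sum, over the geodesics from [x] to [y], of the product of the edge weights
   divided by the product of the potentials at the interior vertices. *)
Definition tunneling_rate : R := (A *m hopping ^+ (gdist e x y).-1) x y.

Lemma potential_ge0 r : 0 <= w 0 r.
Proof.
have [->|rx] := eqVneq r x; first by rewrite w_x.
by have [->|ry] := eqVneq r y; [rewrite w_y|exact/ltW/w_gt0].
Qed.

Lemma hopping_ge0 r s : 0 <= hopping r s.
Proof. by rewrite mxE divr_ge0 ?weight_ge0 ?potential_ge0. Qed.

Lemma hopping_exprS j r s :
  (hopping ^+ j.+1) r s = (A *m hopping ^+ j) r s / w 0 r.
Proof.
rewrite exprS [LHS]mxE [X in _ = X / _]mxE mulr_suml; apply: eq_bigr => t _.
by rewrite [hopping r t]mxE mulrAC.
Qed.

Lemma tunneling_rate_gt0 : 0 < tunneling_rate.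
Proof.
have [s xs dx] := gdist_closer conn xy.
rewrite /tunneling_rate dx.
apply: (mulmx_expmx_gt0 hopping_ge0 (weight_ge0 x) (A_edge xs)).
apply: (expmx_gdist_gt0 conn hopping_ge0 (k := gdist e s y)) => // r t r_le ry rt.
have rx : r != x by apply: contraTneq r_le => ->; rewrite dx ltnn.
by rewrite mxE divr_gt0 ?A_edge ?w_gt0.
Qed.

Section Doublet.
Variables (E_even E_odd : R -> R) (z_even z_odd : R -> 'cV[R]_n).
Hypothesis branch_even : well_branch 1 E_even z_even.
Hypothesis branch_odd : well_branch (-1) E_odd z_odd.

Definition half_sum Q : 'cV[R]_n := 2^-1 *: (z_even Q + z_odd Q).
Definition half_diff Q : 'cV[R]_n := 2^-1 *: (z_even Q - z_odd Q).
Definition splitting Q : R := (E_odd Q - E_even Q) / 2.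
Definition mean_energy Q : R := (E_even Q + E_odd Q) / 2.

Lemma half_diff_row Q r : (Q * w 0 r - mean_energy Q) * half_diff Q r 0 =
  (A *m half_diff Q) r 0 - splitting Q * half_sum Q r 0.
Proof.
have -> : (A *m half_diff Q) r 0 = ((A *m z_even Q) r 0 - (A *m z_odd Q) r 0) / 2.
  rewrite /half_diff -scalemxAr mulmxBr.
  by move: (A *m z_even Q) (A *m z_odd Q) => Az_even Az_odd; rewrite !mxE mulrC.
rewrite -(branch_row _ _ branch_even) -(branch_row _ _ branch_odd).
by rewrite !mxE /mean_energy /splitting; field.
Qed.

Lemma half_sum_x Q : half_sum Q x 0 = 1.
Proof. by rewrite !mxE (branch_x branch_even) (branch_x branch_odd); lra. Qed.

Lemma half_diff_x Q : half_diff Q x 0 = 0.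
Proof. by rewrite !mxE (branch_x branch_even) (branch_x branch_odd); lra. Qed.

Lemma half_diff_y Q : half_diff Q y 0 = 1.
Proof. by rewrite !mxE (branch_y branch_even) (branch_y branch_odd); lra. Qed.

Lemma splittingE Q : splitting Q = (A *m half_diff Q) x 0.
Proof. by have := half_diff_row Q x; rewrite half_diff_x half_sum_x; lra. Qed.

Lemma half_sum_interior_cvg0 r : r != x -> r != y ->
  half_sum Q r 0 @[Q --> +oo] --> 0.
Proof.
move=> rx ry; rewrite -[X in _ --> X](_ : 2^-1 * (0 + 0) = 0); last by ring.
under eq_fun do rewrite mxE [X in _ * X]mxE.
apply: cvgMl_tmp; apply: cvgD.
  by apply: branch_interior_cvg0 branch_even _ rx ry; rewrite normr1.
by apply: branch_interior_cvg0 branch_odd _ rx ry; rewrite normrN1.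
Qed.

Lemma half_diff_cvg_indicator r :
  half_diff Q r 0 @[Q --> +oo] --> ((r == y)%:R : R).
Proof.
have [->|ry] := eqVneq r y.
  by under eq_fun do rewrite half_diff_y; exact: cvg_cst.
have [->|rx] := eqVneq r x.
  by under eq_fun do rewrite half_diff_x; exact: cvg_cst.
rewrite -[X in _ --> X](subrr 0).
have -> : (fun Q => half_diff Q r 0) = fun Q => z_even Q r 0 - half_sum Q r 0.
  by apply/funext => Q; rewrite !mxE; field.
apply: cvgB; last exact: half_sum_interior_cvg0.
by apply: branch_interior_cvg0 branch_even _ rx ry; rewrite normr1.
Qed.

Lemma leakage_cvg0 : leakage x y (z_even Q) (z_odd Q) @[Q --> +oo] --> 0.
Proof.
have <- : \sum_(r | (r != x) && (r != y)) 0 = 0 :> R by exact: big1.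
apply: cvg_big => [|r /andP[rx ry]]; first exact: add_continuous.
exact/norm_cvg0P/half_sum_interior_cvg0.
Qed.

Lemma mean_energy_bounded : exists K, forall Q, `|mean_energy Q| <= K.
Proof.
have [[K_even even_le] [K_odd odd_le]] :=
  (branch_energy_bounded branch_even, branch_energy_bounded branch_odd).
exists ((K_even + K_odd) / 2) => Q; rewrite normrM [`|2^-1|]ger0_norm // ler_pM2r //.
exact: le_trans (ler_normD _ _) (lerD _ _).
Qed.

Lemma neighbour_sum_cvg j r :
  (forall s, (j <= gdist e s y)%N ->
     half_diff Q s 0 * Q ^+ j @[Q --> +oo] --> (hopping ^+ j) s y) ->
  (j < gdist e r y)%N ->
  (A *m half_diff Q) r 0 * Q ^+ j @[Q --> +oo] --> (A *m hopping ^+ j) r y.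
Proof.
move=> amplitude_cvg j_lt; rewrite [X in _ --> X]mxE.
under eq_fun do rewrite mxE mulr_suml.
apply: cvg_big => [|s _]; first exact: add_continuous.
under eq_fun do rewrite -mulrA.
have [rs|/A_nonedge ->] := boolP (e r s).
  apply: cvgMl_tmp; apply: amplitude_cvg; rewrite -ltnS.
  exact: leq_trans j_lt (gdist_edge conn y rs).
by under eq_fun do rewrite mul0r; rewrite mul0r; exact: cvg_cst.
Qed.

Lemma half_diff_cvg j r : (j <= gdist e x y)%N -> (j <= gdist e r y)%N ->
  half_diff Q r 0 * Q ^+ j @[Q --> +oo] --> (hopping ^+ j) r y.
Proof.
elim: j r => [|j IHj] r le_jx le_jr.
  rewrite expr0 [X in _ --> X]mxE; under eq_fun do rewrite expr0 mulr1.
  exact: half_diff_cvg_indicator.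
have [->|rx] := eqVneq r x.
  under eq_fun do rewrite half_diff_x mul0r.
  by rewrite hopping_exprS w_x invr0 mulr0; exact: cvg_cst.
have ry : r != y by rewrite -(gdist_eq0 conn) -lt0n; exact: leq_ltn_trans le_jr.
have amplitude_cvg s := IHj s (ltnW le_jx).
have sum_cvg := neighbour_sum_cvg amplitude_cvg le_jr.
have splitting_cvg : splitting Q * Q ^+ j @[Q --> +oo] --> (A *m hopping ^+ j) x y.
  by under eq_fun do rewrite splittingE; exact: neighbour_sum_cvg amplitude_cvg le_jx.
have source_cvg : (A *m half_diff Q) r 0 * Q ^+ j -
    splitting Q * Q ^+ j * half_sum Q r 0 @[Q --> +oo] --> (A *m hopping ^+ j) r y.
  rewrite -[X in _ --> X]subr0 -[X in _ - X](mulr0 ((A *m hopping ^+ j) x y)).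
  by apply: cvgB => //; apply: cvgM => //; exact: half_sum_interior_cvg0.
rewrite hopping_exprS.
apply: cvg_trans (cvgM source_cvg (scaled_resolvent_cvg mean_energy_bounded rx ry)).
apply: near_eq_cvg.
have := barrier_dominates (fun=> 0) mean_energy_bounded.
apply: filterS => Q /(_ r rx ry) barrier /=.
rewrite [splitting Q * _ * _]mulrAC -mulrBl -half_diff_row exprS.
by field; rewrite gt_eqF.
Qed.

Lemma splitting_cvg :
  splitting Q * Q ^+ (gdist e x y).-1 @[Q --> +oo] --> tunneling_rate.
Proof.
have d_gt0 : (0 < gdist e x y)%N by rewrite lt0n gdist_eq0.
under eq_fun do rewrite splittingE.
apply: neighbour_sum_cvg; last by rewrite prednK.
by move=> s; apply: half_diff_cvg; exact: leq_pred.
Qed.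
End Doublet.

Definition well_state (eps : R) : 'cV[R]_n :=
  \col_r ((r == x)%:R + eps * (r == y)%:R).

Lemma dotcv_well_state (eps : R) z : dotcv z (well_state eps) = z x 0 + eps * z y 0.
Proof.
rewrite dotcvE (bigD1 x) //= (bigD1 y) 1?eq_sym //= big1 => [|r /andP[rx ry]].
  by rewrite !mxE !eqxx [y == x]eq_sym (negbTE xy) /=; ring.
by rewrite mxE (negbTE rx) (negbTE ry) /=; ring.
Qed.

Lemma double_well_well_state (eps Q : R) :
  double_well Q *m well_state eps = - (A *m well_state eps).
Proof.
rewrite /double_well mulmxBl -scalemxAl mul_diag_mx -[RHS]add0r; congr (_ + _).
apply/matrixP => r j; rewrite !mxE.
have [->|rx] := eqVneq r x; first by rewrite w_x; ring.
by have [->|ry] := eqVneq r y; rewrite ?w_y /=; ring.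
Qed.

Section Reflection.
Variable s : {perm 'I_n}.
Hypothesis sK : (s * s = 1)%g.
Hypothesis s_x : s x = y.
Hypothesis A_sym : A^T = A.
Hypothesis A_s : forall r t, A (s r) (s t) = A r t.
Hypothesis w_s : forall r, w 0 (s r) = w 0 r.

Lemma reflectionK r : s (s r) = r.
Proof. by rewrite -permM sK perm1. Qed.

Lemma reflectionV : (s^-1 = s)%g.
Proof. by apply/eqP; rewrite eq_invg_mul sK. Qed.

Lemma double_well_sym Q : (double_well Q)^T = double_well Q.
Proof. by rewrite /double_well linearB linearZ /= tr_diag_mx A_sym. Qed.

Lemma reflection_double_wellC Q :
  perm_mx s *m double_well Q = double_well Q *m perm_mx s.
Proof.
rewrite -row_permE -[in RHS]reflectionV -col_permE; apply/matrixP => r t.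
by rewrite !mxE -[in LHS](reflectionK t) A_s (inj_eq perm_inj) w_s.
Qed.

Lemma reflectionE (z : 'cV[R]_n) r : (perm_mx s *m z) r 0 = z (s r) 0.
Proof. by rewrite -row_permE mxE. Qed.

Lemma well_eigenvector (eps : R) : eps * eps = 1 ->
  forall Q, exists Ez : R * 'cV[R]_n,
    [/\ `|Ez.1| <= Num.sqrt (dotcv (A *m well_state eps) (A *m well_state eps)),
        double_well Q *m Ez.2 = Ez.1 *: Ez.2, Ez.2 x 0 = 1 & Ez.2 y 0 = eps].
Proof.
move=> epsK Q; set f := well_state eps; set K := dotcv _ _.
have ff : dotcv f f = 2.
  by rewrite dotcv_well_state !mxE !eqxx [y == x]eq_sym (negbTE xy) /=; lra.
have Sf : perm_mx s *m f = eps *: f.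
  apply/matrixP => r j; rewrite (ord1 j) reflectionE !mxE -[x in s r == x]reflectionK.
  by rewrite s_x -{2}s_x !(inj_eq perm_inj) mulrDr mulrA epsK mul1r addrC.
have S_sym : (perm_mx s)^T = perm_mx s :> 'M[R]_n.
  by rewrite tr_perm_mx reflectionV.
have SS : perm_mx s *m perm_mx s = 1%:M :> 'M[R]_n by rewrite -perm_mxM sK perm_mx1.
have [] := symmetric_eigenvector_overlap_parity (double_well_sym Q) S_sym SS
  (reflection_double_wellC Q) epsK Sf; first by rewrite ff.
move=> E [z [zE Sz zf0]].
rewrite double_well_well_state ff dotcvNN -/K => E_le.
have zy : z y 0 = eps * z x 0 by rewrite -s_x -reflectionE Sz mxE.
have zx0 : z x 0 != 0.
  by apply: contra zf0 => /eqP zx; rewrite dotcv_well_state zy zx !mulr0 addr0.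
exists (E, (z x 0)^-1 *: z); split => /=.
- by rewrite -sqrtr_sqr ler_wsqrtr //; have := sqr_ge0 E; lra.
- by rewrite -scalemxAr zE !scalerA mulrC.
- by rewrite mxE mulVf.
- by rewrite mxE zy mulrCA mulVf // mulr1.
Qed.

Lemma well_branch_exists (eps : R) : eps * eps = 1 -> exists E z, well_branch eps E z.
Proof.
move=> epsK; have [Ez EzP] := choice (well_eigenvector epsK).
exists (fun Q => (Ez Q).1), (fun Q => (Ez Q).2).
by split=> [|Q|Q|Q]; [eexists=> Q|..]; case: (EzP Q) => // bound _ _ _; exact: bound.
Qed.

Lemma double_well_rabi (shift : R -> R) : exists rate : R -> R,
  rabi_oscillation (fun Q => (shift Q)%:M + double_well Q) x y rate /\
  rate Q * Q ^+ (gdist e x y).-1 @[Q --> +oo] --> tunneling_rate.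
Proof.
have [E_even [z_even branch_even]] := well_branch_exists (mulr1 1).
have [|E_odd [z_odd branch_odd]] := @well_branch_exists (-1).
  by rewrite mulrNN mulr1.
exists (splitting E_even E_odd); split; last first.
  exact: splitting_cvg branch_even branch_odd.
move=> eps eps_gt0.
have leakage_small : \forall Q \near +oo, `|leakage x y (z_even Q) (z_odd Q)| < eps / 4.
  apply: cvgr_norm_lt (leakage_cvg0 branch_even branch_odd) _ _.
  by rewrite normr0 divr_gt0.
apply: filterS leakage_small => Q leak t.
have H_sym : ((shift Q)%:M + double_well Q)^T = (shift Q)%:M + double_well Q.
  by rewrite linearD /= tr_scalar_mx double_well_sym.
have := amp2_two_level xy H_sym (branch_shift_eigen (shift Q) Q branch_even)
  (branch_shift_eigen (shift Q) Q branch_odd)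
  (branch_x branch_even Q) (branch_y branch_even Q)
  (branch_x branch_odd Q) (branch_y branch_odd Q) t.
rewrite opprD addrACA subrr add0r => /le_trans; apply.
by move: leak; rewrite ltr_norml => /andP[_]; lra.
Qed.
End Reflection.
End DoubleWell.

Section GraphHamiltonian.
Variables (R : realType) (n : nat) (e : rel 'I_n).
Hypothesis simple : simple_graph e.

(* [degree] counts a classical set; [finset] is its decidable counterpart. *)
Lemma degreeE v : degree R e v = #|finset (e v)|%:R.
Proof.
rewrite /degree; congr (_%:R); apply: eq_card => u; rewrite [RHS]inE.
by apply/idP/idP; rewrite in_setE.
Qed.

Lemma degree_gt0 r s : e r s -> 0 < degree R e r.
Proof.
by move=> rs; rewrite degreeE ltr0n card_gt0; apply/set0Pn; exists s; rewrite inE.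
Qed.

Lemma degree_aut sigma v : graph_aut e sigma -> degree R e (sigma v) = degree R e v.
Proof.
move=> [sigma_bij e_sigma]; rewrite !degreeE; congr (_%:R).
rewrite -(card_preimset (finset (e (sigma v))) (bij_inj sigma_bij)).
by apply: eq_card => u; rewrite !inE e_sigma.
Qed.

Definition normalized_adjacency : 'M[R]_n := 1%:M - sym_laplacian R e.

Lemma normalized_adjacencyE r s : normalized_adjacency r s =
  if e r s then (Num.sqrt (degree R e r * degree R e s))^-1 else 0.
Proof.
rewrite !mxE; have [->|rs] := eqVneq r s; first by rewrite (proj2 simple) subrr.
by rewrite mulr0n sub0r; case: ifP; rewrite ?opprK ?oppr0.
Qed.

Lemma normalized_adjacency_gt0 r s : e r s -> 0 < normalized_adjacency r s.
Proof.
move=> rs; rewrite normalized_adjacencyE rs invr_gt0 sqrtr_gt0.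
by rewrite mulr_gt0 ?(degree_gt0 rs) // (@degree_gt0 s r) // (proj1 simple).
Qed.

Lemma normalized_adjacency_nonedge r s : ~~ e r s -> normalized_adjacency r s = 0.
Proof. by rewrite normalized_adjacencyE => /negbTE ->. Qed.

Lemma normalized_adjacency_sym : normalized_adjacency^T = normalized_adjacency.
Proof.
apply/matrixP => r s; rewrite [LHS]mxE !normalized_adjacencyE (proj1 simple).
by rewrite [degree R e s * _]mulrC.
Qed.

Lemma normalized_adjacency_aut sigma r s : graph_aut e sigma ->
  normalized_adjacency (sigma r) (sigma s) = normalized_adjacency r s.
Proof.
by move=> aut; rewrite !normalized_adjacencyE !(degree_aut _ aut) (proj2 aut).
Qed.

Lemma hamiltonian_double_well W (c Q : R) : hamiltonian e W Q =
  (1 - Q * c)%:M + double_well normalized_adjacency (\row_v (c - W v)) Q.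
Proof.
rewrite /hamiltonian /double_well /normalized_adjacency.
move: (sym_laplacian R e) => L; apply/matrixP => r s; rewrite !mxE.
by have [->|rs] := eqVneq r s; rewrite ?mulr1n ?mulr0n; ring.
Qed.

Lemma hamiltonian_sym (W : 'I_n -> R) Q : (hamiltonian e W Q)^T = hamiltonian e W Q.
Proof.
rewrite (hamiltonian_double_well W 0) linearD /= tr_scalar_mx.
by rewrite (double_well_sym _ normalized_adjacency_sym).
Qed.

Lemma hamiltonian_rabi (W : 'I_n -> R) (x y : 'I_n) (sigma : 'I_n -> 'I_n) :
  connected_graph e -> x != y ->
  (forall v, W v <= W x) -> W y = W x ->
  (forall v, W v = W x -> v = x \/ v = y) ->
  graph_aut e sigma -> (forall v, sigma (sigma v) = v) ->
  sigma x = y -> (forall v, W (sigma v) = W v) ->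
  exists (rate : R -> R) (kappa : R),
    [/\ rabi_oscillation (hamiltonian e W) x y rate, 0 < kappa &
        rate Q * Q ^+ (gdist e x y).-1 @[Q --> +oo] --> kappa].
Proof.
move=> conn xy W_max W_y W_unique aut sigmaK sigma_x W_sigma.
pose w : 'rV[R]_n := \row_v (W x - W v); pose s := perm (can_inj sigmaK).
have w_x : w 0 x = 0 by rewrite mxE subrr.
have w_y : w 0 y = 0 by rewrite mxE W_y subrr.
have w_gt0 r : r != x -> r != y -> 0 < w 0 r.
  move=> rx ry; rewrite mxE subr_gt0 lt_neqAle W_max andbT.
  by apply/eqP => /W_unique[] rE; rewrite rE eqxx in rx ry.
have sK : (s * s = 1)%g by apply/permP => r; rewrite permM !permE sigmaK.
have s_x : s x = y by rewrite permE.
have A_s r t : normalized_adjacency (s r) (s t) = normalized_adjacency r t.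
  by rewrite !permE normalized_adjacency_aut.
have w_s r : w 0 (s r) = w 0 r by rewrite !mxE permE W_sigma.
have [rate [rabi rate_cvg]] := double_well_rabi conn xy normalized_adjacency_gt0
  normalized_adjacency_nonedge w_x w_y w_gt0 sK s_x normalized_adjacency_sym A_s w_s
  (fun Q => 1 - Q * W x).
exists rate, (tunneling_rate e x y normalized_adjacency w); split; last exact: rate_cvg.
  suff -> : hamiltonian e W =
      fun Q => (1 - Q * W x)%:M + double_well normalized_adjacency w Q by exact: rabi.
  by apply/funext => Q; exact: hamiltonian_double_well.
exact: tunneling_rate_gt0 conn xy normalized_adjacency_gt0 normalized_adjacency_nonedge
  w_x w_y w_gt0.
Qed.
End GraphHamiltonian.

Theorem theorem5 (R : realType) (n : nat) (e : rel 'I_n) (W : 'I_n -> R)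
    (x y : 'I_n) (sigma : 'I_n -> 'I_n) :
  simple_graph e -> connected_graph e -> x != y ->
  (forall v, W v <= W x) -> W y = W x ->
  (forall v, W v = W x -> v = x \/ v = y) ->
  graph_aut e sigma -> (forall v, sigma (sigma v) = v) ->
  sigma x = y -> (forall v, W (sigma v) = W v) ->
  TC e W x y = 1%E /\ TC e W y x = 1%E /\
  tunneling_time_of_order e W x y (fun Q => Q ^+ (gdist e x y).-1) /\
  tunneling_time_of_order e W y x (fun Q => Q ^+ (gdist e x y).-1).
Proof.
move=> simple conn xy W_max W_y W_unique aut sigmaK sigma_x W_sigma.
have [rate [kappa [rabi_xy kappa_gt0 rate_cvg]]] :=
  hamiltonian_rabi simple conn xy W_max W_y W_unique aut sigmaK sigma_x W_sigma.
have rabi_yx := rabi_oscillationC (hamiltonian_sym simple W) rabi_xy.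
have g_gt0 : \forall Q \near +oo, 0 < Q ^+ (gdist e x y).-1 :> R.
  by apply: filterS (nbhs_pinfty_gt (num_real 0)) => Q; exact: exprn_gt0.
split; first exact: rabi_TC rabi_xy g_gt0 kappa_gt0 rate_cvg.
split; first exact: rabi_TC rabi_yx g_gt0 kappa_gt0 rate_cvg.
split; first exact: rabi_tunneling_time_of_order rabi_xy g_gt0 kappa_gt0 rate_cvg.
exact: rabi_tunneling_time_of_order rabi_yx g_gt0 kappa_gt0 rate_cvg.
Qed.
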